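(* For every $\varepsilon>0$ there exists $\delta=\delta(\varepsilon)>0$ such that for every sufficiently large integer $n$ the following holds. Every set $A\subseteq [n]$ of size $|A|\ge (\frac13-\delta)\cdot n$ either contains at least $\delta\cdot n^{k-1}$ sets from $\mathcal{F}^{(k)}_n$ for some $k\in\{3,4,5\}$, or satisfies $|A\setminus B_n|\le \varepsilon n$.
   Context: $[n]=\{1,\ldots,n\}$, and $B_n=\{\lceil \frac23(n+1)\rceil,\ldots,n\}$. $\mathcal{F}^{(3)}_n$ denotes the collection of all sets $\{x,y,z\}\subseteq[n]$ of distinct $x,y,z$ satisfying $x+y=z$ or $x+y+z=2n+1$. For $k\ge 4$, $\mathcal{F}^{(k)}_n$ denotes the collection of all sets $\{x_1,\ldots,x_k\}\subseteq[n]$ of distinct $x_1,\ldots,x_k$ satisfying $\sum_{i=1}^k x_i=2n+1$. ''$A$ contains a set $F$ from the collection'' means $F\subseteq A$. The ''or'' is inclusive. The threshold for ''sufficiently large'' may depend on $\varepsilon$. *)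

(* Defs.v *)
From HB Require Import structures.
From mathcomp Require Import all_boot all_order all_algebra.

Set Implicit Arguments.
Unset Strict Implicit.
Unset Printing Implicit Defensive.

Import Order.TTheory GRing.Theory Num.Theory.

(* Sets of integers between 1 and n are represented as sets A : {set 'I_n.+1}
   with A \subset segment n: an element of 'I_n.+1 is its own value, and the
   extra element 0 is excluded by the inclusion. *)
Definition segment (n : nat) : {set 'I_n.+1} := [set x : 'I_n.+1 | 0 < x].

Definition top_third (n : nat) : {set 'I_n.+1} :=
  [set x in segment n |
    (Num.ceil ((2%:R / 3%:R) * (n.+1)%:R : rat)%R <= (x : nat)%:Z)%R].

Definition family3 (n : nat) : {set {set 'I_n.+1}} :=
  [set F : {set 'I_n.+1} | (F \subset segment n) &&
    [exists x : 'I_n.+1, exists y : 'I_n.+1, exists z : 'I_n.+1,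
      [&& x != y, x != z, y != z, F == [set x; y; z]
        & (x + y == z :> nat) || (x + y + z == 2 * n + 1)]]].

Definition sum_family (n k : nat) : {set {set 'I_n.+1}} :=
  [set F : {set 'I_n.+1} |
    [&& F \subset segment n, #|F| == k & \sum_(x in F) (x : nat) == 2 * n + 1]].

(* Only meant for 3 <= k. *)
Definition config_family (n k : nat) : {set {set 'I_n.+1}} :=
  if k == 3 then family3 n else sum_family n k.

(* Main.v *)
(* With N = 2n + 1, let D be the set of popular sums, i.e. the s having many
   representations s = x + y in A. If A contains few configurations, then A,
   N - A, D and N - D are almost disjoint in [0, N], so that |A| >= n/3 forces
   |D| <= (2 + o(1)) |A|. This is the extremal case of Freiman's 3k - 4 theorem,
   which has an easy robust proof: discard the few x in A for which x + A is not
   almost contained in D, and let u and v be the extreme remaining elements. As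
   u + A and v + A are almost disjoint, D is almost their union; hence modulo
   v - u the set A - u is almost invariant under translation by its own elements,
   so it almost fills a subgroup, whose index is at most 3 because |A| > n/4. Thus
   A is almost an arithmetic progression of difference d <= 3, and D is almost the
   corresponding progression in [2u, 2v]. Comparing D with A, N - A, N - D and
   N - c - D (c in A), that is, using x + y = z and the sums of 3, 4 and 5
   elements, leaves only d = 1 and u >= 2n/3 - o(n). *)

Require Import Defs.
From HB Require Import structures.
From mathcomp Require Import all_boot all_order all_algebra.
From mathcomp Require Import reals.
From mathcomp Require Import zify ring lra.

Set Implicit Arguments.
Unset Strict Implicit.
Unset Printing Implicit Defensive.

Import Order.TTheory GRing.Theory Num.Theory.

(** * Sets with many almost periods *)

Section AlmostPeriods.
Variables (G : finZmodType) (X : {set G}).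
Local Open Scope ring_scope.

Let overlap (t : G) : nat := #|[set y in X | t + y \in X]|.
Let defect (t : G) : nat := #|[set y in X | t + y \notin X]|.

Lemma overlap_defect t : (overlap t + defect t = #|X|)%N.
Proof.
rewrite /overlap /defect -(cardsID [set y | t + y \in X] X).
by congr (_ + _)%N; apply: eq_card => y; rewrite !inE // andbC.
Qed.

Lemma defect_opp t : defect (- t) = defect t.
Proof.
have ovN s : (overlap s <= overlap (- s))%N.
  rewrite /overlap -(card_imset _ (addrI s)); apply: subset_leq_card.
  apply/subsetP=> z /imsetP[y]; rewrite !inE => /andP[yX syX] ->.
  by rewrite syX addKr.
have : overlap (- t) = overlap t.
  by apply/eqP; rewrite eqn_leq ovN -{2}[t]opprK ovN.
by have := overlap_defect t; have := overlap_defect (- t); lia.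
Qed.

Lemma defectD s t : (defect (s + t)%R <= defect s + defect t)%N.
Proof.
rewrite /defect addnC -(card_imset [set y in X | s + y \notin X] (addrI (- t))).
apply: leq_trans (leq_card_setU _ _); apply: subset_leq_card.
apply/subsetP=> y; rewrite !inE => /andP[yX sty].
case tyX: (t + y \in X); rewrite yX //=.
by apply/imsetP; exists (t + y); rewrite ?addKr // inE tyX addrA.
Qed.


Lemma sum_overlap : (\sum_t overlap t = #|X| * #|X|)%N.
Proof.
have ovE t : overlap t = (\sum_(y in X) ((t + y)%R \in X))%N.
  rewrite /overlap -sum1_card -big_mkcondr; apply: eq_bigl => y.
  by rewrite !inE.
under eq_bigr do rewrite ovE; rewrite exchange_big /= -sum_nat_const.
apply: eq_bigr => y _; rewrite (reindex_inj (addIr (- y))) /=.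
rewrite -sum1_card [RHS]big_mkcond; apply: eq_bigr => t _.
by rewrite subrK; case: (t \in X).
Qed.

Let periods k := [set t | (defect t <= k)%N].

(** Each member of [periods k] contributes at least |X| - k to the sum of all overlaps, which is
    |X|^2. *)
Lemma periods_card k : (#|periods k| * (#|X| - k) <= #|X| * #|X|)%N.
Proof.
rewrite -sum_overlap -sum_nat_const.
apply: (@leq_trans (\sum_(t in periods k) overlap t)%N).
  by apply: leq_sum => t; rewrite inE => tk; have := overlap_defect t; lia.
by rewrite [leqRHS](bigID (mem (periods k))) leq_addr.
Qed.

(* The almost periods form a set of doubling less than 3/2, so their
   difference set is a subgroup. *)
Lemma almost_closed_sub_subgroup k : (6 * k < #|X|)%N -> 0 \in X ->
  {in X, forall t, (defect t <= k)%N} ->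
  exists K : {set G}, [/\ X \subset K, {in K &, forall s t, s + t \in K},
    {in K, forall t, - t \in K} & (#|K| <= #|X| + 3 * k)%N].
Proof.
move=> ltkX X0 Xk; set H := periods k; set H2 := periods (k + k).
have HN t : t \in H -> - t \in H by rewrite !inE defect_opp.
have HD s t : s \in H -> t \in H -> s + t \in H2.
  by rewrite !inE => sk tk; apply: leq_trans (defectD s t) (leq_add sk tk).
have XH : X \subset H by apply/subsetP=> t tX; rewrite inE Xk.
have XleH := subset_leq_card XH.
have H2le : (#|H2| <= #|X| + 3 * k)%N.
  (* As 6k < |X|, the quotient |X|^2 / (|X| - 2k) is below |X| + 3k + 1. *)
  have := periods_card (k + k); rewrite -/H2; nia.
pose K := [set (s - t : G) | s : G in H, t : G in H].
have KH2 : K \subset H2.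
  by apply/subsetP=> t /imset2P[u v uH vH ->]; apply/HD/HN.
pose Y (u : G) := [set y in H | u + y \in H].
(* For u = s - t the translates [s + H] and [t + H] lie in [H2], whose size is below 3/2 |H|, so
   they share more than |H| / 2 points. *)
have half (u : G) : u \in K -> (#|H| < 2 * #|Y u|)%N.
  case/imset2P=> s t sH tH ->.
  set S := [set (s + y : G) | y : G in H]; set T := [set (t + y : G) | y : G in H].
  have sE : #|S| = #|H| by rewrite card_imset //; apply: addrI.
  have tE : #|T| = #|H| by rewrite card_imset //; apply: addrI.
  have /subset_leq_card : S :&: T \subset [set (s + y : G) | y : G in Y (s - t)].
    apply/subsetP=> _ /setIP[/imsetP[a aH ->] /imsetP[b bH e]].
    apply/imsetP; exists a => //; rewrite inE aH /=.
    suff -> : s - t + a = b by [].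
    by rewrite addrAC e addrAC subrr add0r.
  rewrite card_imset; last exact: addrI.
  have /subset_leq_card : S :|: T \subset H2.
    by rewrite subUset; apply/andP; split; apply/subsetP=> _ /imsetP[y yH ->];
      apply: HD.
  have := cardsUI S T.
  by rewrite sE tE; lia.
have H0 : 0 \in H by apply: (subsetP XH).
have KN (u : G) : u \in K -> - u \in K.
  by case/imset2P=> s t sH tH ->; rewrite opprB; apply: imset2_f.
exists K; split=> //.
- apply: subset_trans XH _; apply/subsetP=> t tH.
  by rewrite -[t]subr0; apply: imset2_f.
- move=> u v uK vK; have := half _ uK; have := half _ (KN _ vK).
  move=> cY cZ.
  (* [Y (- v)] and [Y u] each contain more than half of [H]; a common [y] exhibits u + v as a
     difference of two elements of [H]. *)
  have /set0Pn[y] : Y (- v) :&: Y u != set0.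
    rewrite -card_gt0; have := cardsUI (Y (- v)) (Y u).
    suff /subset_leq_card : Y (- v) :|: Y u \subset H by lia.
    by rewrite subUset; apply/andP; split; apply/subsetP=> y; rewrite inE => /andP[].
  rewrite !inE => /andP[/andP[_ vyk] /andP[_ uyk]].
  have -> : u + v = (u + y) - (- v + y) by rewrite opprD opprK addrACA subrr addr0.
  by apply: imset2_f; rewrite inE.
- by apply: leq_trans H2le; apply: subset_leq_card.
Qed.

End AlmostPeriods.

(** * Counting natural numbers below a bound *)

(** A sum of Booleans, so that inequalities between counts can be checked pointwise. *)
Definition cnt (M : nat) (p : pred nat) : nat := \sum_(x < M) p x.

Section Cnt.
Implicit Types p q : pred nat.

Lemma cntE M p : cnt M p = #|[set x : 'I_M | p x]|.
Proof.
by rewrite /cnt -sum1_card [RHS]big_mkcond; apply: eq_bigr => x _; rewrite inE; case: (p x).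
Qed.

Lemma cnt_sub M p q : (forall x, x < M -> p x -> q x) -> cnt M p <= cnt M q.
Proof.
by move=> h; apply: leq_sum => x _; have := h x (ltn_ord x); case: (p x) => // ->.
Qed.

Lemma cnt_sub2 M p q1 q2 : (forall x, x < M -> p x -> q1 x || q2 x) ->
  cnt M p <= cnt M q1 + cnt M q2.
Proof.
move=> h; rewrite /cnt -big_split; apply: leq_sum => x _ /=.
by have := h x (ltn_ord x); case: (p x) => // /(_ isT); case: (q1 x); case: (q2 x).
Qed.

Lemma cntUI M p q :
  cnt M p + cnt M q = cnt M (fun x => p x || q x) + cnt M (fun x => p x && q x).
Proof.
by rewrite /cnt -!big_split; apply: eq_bigr => x _ /=; case: (p x); case: (q x).
Qed.

Lemma cnt_inj M M' p q (f : nat -> nat) :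
  (forall x, x < M -> p x -> f x < M' /\ q (f x)) ->
  (forall x y, x < M -> y < M -> p x -> p y -> f x = f y -> x = y) ->
  cnt M p <= cnt M' q.
Proof.
move=> pq fi; rewrite !cntE; case: M' => [|M'] in pq *.
  rewrite (_ : [set x : 'I_M | p x] = set0) ?cards0 //.
  by apply/setP=> x; rewrite !inE; apply/negP=> /(pq x (ltn_ord x))[].
rewrite -(card_in_imset (f := fun x : 'I_M => inord (f x) : 'I_M'.+1)).
  apply: subset_leq_card; apply/subsetP=> _ /imsetP[x + ->]; rewrite !inE => px.
  by have [fx qx] := pq x (ltn_ord x) px; rewrite inordK.
move=> x y; rewrite !inE => px py /(congr1 val) /=.
have [fx _] := pq x (ltn_ord x) px; have [fy _] := pq y (ltn_ord y) py.
by rewrite !inordK // => /(fi x y (ltn_ord x) (ltn_ord y) px py) /val_inj.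
Qed.

Lemma cnt_refl N p : cnt N.+1 (fun x => p (N - x)) = cnt N.+1 p.
Proof.
rewrite /cnt (reindex_inj rev_ord_inj) /=; apply: eq_bigr => x _.
by rewrite subSS subKn // -ltnS.
Qed.

Lemma cnt_gt0 M p : 0 < cnt M p -> exists2 x, x < M & p x.
Proof. by rewrite cntE card_gt0 => /set0Pn[x]; rewrite inE; exists x. Qed.

Lemma cnt_eq1 M w : cnt M (pred1 w) <= 1.
Proof.
rewrite cntE; apply/card_le1P=> x; rewrite inE => /eqP xw y; rewrite !inE /= -xw.
by rewrite -val_eqE.
Qed.

Lemma cnt_predT M : cnt M predT = M.
Proof. by rewrite /cnt sum1_card card_ord. Qed.

Lemma cnt_interval M lo hi : cnt M (fun x => lo <= x < hi) <= hi - lo.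
Proof.
rewrite -[X in _ <= X]cnt_predT.
by apply: (cnt_inj (f := subn^~ lo)) => [x _ h|x y _ _ h h'] /=; lia.
Qed.

(** Markov's inequality: each counted [x] contributes at least e + 1, so [e] of them would exceed
    e^2. *)
Lemma cnt_markov M p (f : nat -> nat) e :
  \sum_(x < M) p x * f x <= e * e -> 0 < e ->
  cnt M (fun x => p x && (e < f x)) < e.
Proof.
move=> h e0; have : cnt M (fun x => p x && (e < f x)) * e.+1 <= e * e.
  apply: leq_trans h; rewrite /cnt big_distrl; apply: leq_sum => x _ /=.
  by case: (p x) => //=; case: ltnP => //= ?; rewrite !mul1n.
by nia.
Qed.

Lemma cnt_AP M d r lo L : 0 < d -> lo + d * L <= M ->
  L <= cnt M (fun x => (lo <= x < lo + d * L) && (x == r %[mod d])).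
Proof.
(* [lo * d.-1] acts as -lo modulo [d], so [lo + c] is the first number from [lo] on in the class of
   [r]. *)
move=> d0 hM; pose c := (lo * d.-1 + r) %% d.
have c_lt : c < d by rewrite ltn_mod.
have cE : lo + c = r %[mod d].
  rewrite /c modnDmr addnA -{1}[lo]muln1 -mulnDr add1n prednK //.
  by rewrite -modnDml modnMl add0n.
rewrite -[X in X <= _]cnt_predT.
apply: (cnt_inj (f := fun j => lo + c + d * j)) => [j jL _|x y _ _ _ _] /=; last by nia.
have := leq_mul (leqnn d) jL; rewrite mulnS => ?; split; first by lia.
rewrite -modnDmr modnMr addn0 cE eqxx andbT; lia.
Qed.

Lemma cnt_overlap M p q d r lo L e1 e2 : 0 < d -> lo + d * L <= M ->
  let J x := (lo <= x < lo + d * L) && (x == r %[mod d]) in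
  cnt M (fun x => J x && ~~ p x) <= e1 -> cnt M (fun x => J x && ~~ q x) <= e2 ->
  L <= e1 + e2 + cnt M (fun x => p x && q x).
Proof.
move=> d0 hM J h1 h2; apply: leq_trans (cnt_AP r d0 hM) _.
apply: leq_trans (leq_add (leq_add h1 h2) (leqnn _)).
rewrite /cnt -!big_split; apply: leq_sum => x _ /=; rewrite -/(J x).
by case: (J x) => //=; case: (p x); case: (q x).
Qed.

(** When [p] and [q] almost fill progressions of difference [d], a number [w] of the right residue
    well inside the sum of the two ranges has many representations: reflecting [q] in [w] reduces
    this to an overlap. *)
Lemma cnt_sum_overlap M p q d r1 r2 w a1 a2 b1 b2 L e1 e2 :
  0 < d -> w < M -> a2 < M -> r1 + r2 == w %[mod d] ->
  cnt M (fun x => [&& a1 <= x <= a2, x == r1 %[mod d] & ~~ p x]) <= e1 ->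
  cnt M (fun x => [&& b1 <= x <= b2, x == r2 %[mod d] & ~~ q x]) <= e2 ->
  a1 + d * L <= a2 -> b1 + d * L <= b2 ->
  a1 + b1 + d * L <= w -> w + d * L <= a2 + b2 ->
  L <= e1 + e2 + cnt M (fun s => [&& s <= w, p s & q (w - s)]).
Proof.
move=> d0 wM aM wE p_miss q_miss; move lE: (d * L) => l le1 le2 le3 le4.
(* The least [s] with a1 <= s and w - s <= b2; the margin conditions leave room for a block of
   length [d * L] from there. *)
pose lo := maxn a1 (w - b2).
have [lo1 lo2 lo3 lo4] : [/\ a1 <= lo, w <= lo + b2, lo + l <= a2 & lo + l + b1 <= w].
  by rewrite /lo; split; lia.
have h : cnt M (fun s => p s && ((s <= w) && q (w - s))) <=
         cnt M (fun s => [&& s <= w, p s & q (w - s)]).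
  by apply: cnt_sub => s _ /and3P[-> -> ->].
apply: leq_trans (leq_add (leqnn _) h).
apply: (@cnt_overlap M p _ d r1 lo) => //; rewrite lE; first by lia.
  apply: leq_trans p_miss; apply: cnt_sub => s _ /andP[/andP[s1 ->] ->].
  by rewrite andbT; lia.
apply: leq_trans q_miss; apply: (cnt_inj (f := subn w)) => [s sM|].
  case/andP=> /andP[s1 su]; have sw : s <= w by lia.
  rewrite sw /= => ->; rewrite andbT; split; first by lia.
  apply/andP; split; first by lia.
  by rewrite -(eqn_modDr s) subnK // -(eqP wE) -[(r2 + s) %% d]modnDmr (eqP su) modnDmr addnC.
by move=> x y _ _ /andP[/andP[x1 _] _] /andP[/andP[y1 _] _]; lia.
Qed.

End Cnt.

(** * A robust form of Freiman's 3k - 4 theorem *)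

(** Four translates of [K] cannot be disjoint, so one of 1, 2, 3 represents an element of [K]; the
    least positive representative generates [K] by division with remainder. *)
Lemma subgroup_small_index m (K : {set 'I_m.+1}) :
  (0 \in K)%R -> {in K &, forall s t, s + t \in K}%R -> {in K, forall t, - t \in K}%R ->
  m.+1 < 4 * #|K| ->
  exists d, [/\ 0 < d <= 3, d %| m.+1 & forall t : 'I_m.+1, (t \in K) = (d %| t)].
Proof.
(* [k] pulls [K] back to the natural numbers, where least elements and remainders make sense. *)
move=> K0 KD KN ltm; pose k t := (inZp t : 'I_m.+1) \in K.
have kD s t : k s -> k t -> k (s + t).
  rewrite /k => sK tK; have -> : (inZp (s + t) = inZp s + inZp t :> 'I_m.+1)%R.
    by apply: val_inj; rewrite /= modnDm.
  exact: KD.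
have kB s t : k s -> k (s + t) -> k t.
  rewrite /k => sK stK; have -> : (inZp t = inZp (s + t) - inZp s :> 'I_m.+1)%R.
    have -> : (inZp (s + t) = inZp s + inZp t :> 'I_m.+1)%R.
      by apply: val_inj; rewrite /= modnDm.
    by rewrite addrAC subrr add0r.
  exact/KD/KN.
have k0 : k 0 by rewrite /k (_ : inZp 0 = 0%R) //; apply: val_inj.
have kM d q : k d -> k (q * d) by move=> kd; elim: q => // q IH; rewrite mulSn kD.
have [i [j [ltij j3 kij]]] : exists i j, [/\ i < j, j <= 3 & k (j - i)].
  pose T (i : 'I_4) : {set 'I_m.+1} := [set (inZp i + t)%R | t : 'I_m.+1 in K].
  have cT i : #|T i| = #|K| by rewrite card_imset //; apply: addrI.
  have [/existsP[i /existsP[j /andP[ltij]]]|] :=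
    boolP [exists i : 'I_4, exists j : 'I_4, (i < j) && ~~ [disjoint T i & T j]].
    rewrite -setI_eq0 => /set0Pn[_ /setIP[/imsetP[s sK ->] /imsetP[t tK e]]].
    exists i, j; split=> //; first by rewrite -ltnS ltn_ord.
    rewrite /k; have -> : (inZp (j - i) = s - t :> 'I_m.+1)%R.
      apply/eqP; rewrite eq_sym subr_eq; apply/eqP.
      apply: (addrI (inZp i)); rewrite e addrA; congr (_ + _)%R.
      by apply: val_inj; rewrite /= modnDm subnKC // ltnW.
    exact/KD/KN.
  rewrite negb_exists => /forallP hd.
  have dT (i j : 'I_4) : i < j -> [disjoint T i & T j].
    move=> ltij; have := hd i; rewrite negb_exists => /forallP/(_ j).
    by rewrite ltij negbK.
  have tT : trivIset [set T i | i : 'I_4].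
    apply/trivIsetP=> _ _ /imsetP[i _ ->] /imsetP[j _ ->] nij.
    case: (ltngtP i j) => [/dT //|/dT|/val_inj ij]; first by rewrite disjoint_sym.
    by rewrite ij eqxx in nij.
  have Kpos : 0 < #|K| by apply/card_gt0P; exists 0%R.
  have Tinj : injective T.
    move=> i j Tij; case: (ltngtP i j) => [/dT|/dT|/val_inj //];
      rewrite Tij -setI_eq0 setIid -cards_eq0 cT; lia.
  have : #|cover [set T i | i : 'I_4]| <= m.+1.
    by rewrite -[X in _ <= X]card_ord max_card.
  rewrite -(eqP tT) big_imset /=; last by move=> i j _ _; apply: Tinj.
  rewrite (eq_bigr (fun=> #|K|)) => [|i _]; last exact: cT.
  by rewrite sum_nat_const card_ord; lia.
have exd : exists d, (0 < d) && k d by exists (j - i); rewrite subn_gt0 ltij.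
case: (ex_minnP exd) => d /andP[d0 kd] dmin.
have kE t : k t = (d %| t).
  apply/idP/idP=> [kt|/dvdnP[q ->]]; last exact: kM.
  rewrite /dvdn; case: posnP => // r0; have ltr := ltn_pmod t d0.
  have : k (t %% d) by apply: (kB (t %/ d * d)); rewrite -?divn_eq //; apply: kM.
  by move=> kr; have := dmin (t %% d); rewrite r0 kr => /(_ isT); lia.
exists d; split.
- by rewrite d0 (leq_trans (dmin (j - i) _)) ?subn_gt0 ?ltij //; lia.
- by rewrite -kE /k (_ : inZp m.+1 = 0%R) //; apply: val_inj; rewrite /= modnn.
- by move=> t; rewrite -kE /k valZpK.
Qed.

Section RobustFreiman.
(* All errors are measured in units of e, a small multiple of n, and D plays the
   role of the set of popular sums of a. *)
Variables (n M e : nat) (a D : pred nat).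
Hypothesis a_le : forall x, a x -> x <= n.
Hypothesis M_gt : 2 * n < M.
Hypothesis e_gt0 : 0 < e.
Hypothesis a_large : n + 8 * e <= 4 * cnt M a.
Hypothesis e_small : 100 * e <= cnt M a.
Hypothesis D_small : cnt M D <= 2 * cnt M a + 5 * e.

(** The failure of [x + a] to lie in [D]. By the bound on its total, fewer than [e] elements of [a]
    exceed [e]; the others are the [good] ones. *)
Let exc x := cnt M (fun s => [&& x <= s, a (s - x) & ~~ D s]).
Hypothesis exc_sum : \sum_(x < M) a x * exc x <= e * e.

Let good x := a x && (exc x <= e).

Let good_lt x : good x -> x < M.
Proof. by case/andP=> /a_le; lia. Qed.

Let good_compl : cnt M (fun x => a x && ~~ good x) < e.
Proof.
have [lt _] := (cnt_markov exc_sum e_gt0, 0); apply: leq_ltn_trans lt.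
by apply: cnt_sub => x _; rewrite /good; case: (a x) => //=; rewrite ltnNge.
Qed.

Let good_card : cnt M a < cnt M good + e.
Proof.
suff : cnt M a <= cnt M good + cnt M (fun x => a x && ~~ good x).
  by move: good_compl; lia.
by apply: cnt_sub2 => x _ ax; rewrite ax; case: (good x).
Qed.

(* The extreme elements u, v of the popular part of a satisfy
   D ~ (u + a) U (v + a), so a - u is almost closed under addition mod v - u. *)
Lemma almost_AP : exists2 a' : pred nat, (forall x, a' x -> a x) /\
    cnt M (fun x => a x && ~~ a' x) <= e &
  exists u v d, [/\ a' u, 0 < d <= 3,
    forall x, a' x -> u <= x <= v /\ x == u %[mod d],
    v == u %[mod d] &
    [/\ d * (cnt M a' - 1) <= v - u, v <= n, 
      cnt M (fun x => [&& u <= x <= v, x == u %[mod d] & ~~ a' x]) <= 33 * e &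
      cnt M (fun s => [&& 2 * u <= s <= 2 * v, s == 2 * u %[mod d] & ~~ D s])
        <= 68 * e]].
Proof.
exists good; first by split=> [x /andP[]//|]; apply: ltnW.
have exg : exists x, good x.
  have /cnt_gt0[x _ gx] : 0 < cnt M good by lia.
  by exists x.
have bound x : good x -> x <= n by case/andP=> /a_le.
case: (ex_minnP exg) => u gu umin; case: (ex_maxnP exg bound) => v gv vmax.
pose shifted w s := (w <= s) && good (s - w).
have card_shifted w : good w -> cnt M good <= cnt M (shifted w).
  move=> /bound wn; apply: (cnt_inj (f := addn w)) => [x _ gx|x y _ _ _ _]; last by lia.
  by have := bound _ gx; rewrite /shifted addKn gx; split; lia.
have shifted_D w : good w -> cnt M (fun s => shifted w s && ~~ D s) <= e.
  case/andP=> _ we; apply: leq_trans we; apply: cnt_sub => s _.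
  by rewrite /shifted -andbA => /and3P[-> /andP[-> _] ->].
pose uv s := shifted u s || shifted v s.
(* [u + v] is the largest element of one translate and the smallest of the other, hence their only
   possible common point. *)
have uv_card : 2 * cnt M good <= cnt M uv + 1.
  have := cntUI M (shifted u) (shifted v); rewrite -/uv.
  have := card_shifted _ gu; have := card_shifted _ gv.
  suff : cnt M (fun s => shifted u s && shifted v s) <= 1 by lia.
  apply: leq_trans (cnt_eq1 M (u + v)); apply: cnt_sub => s _ /=.
  by case/andP=> /andP[us /vmax sv] /andP[vs /umin su]; apply/eqP; lia.
have uv_D : cnt M (fun s => uv s && ~~ D s) <= 2 * e.
  rewrite mul2n -addnn; apply: leq_trans (leq_add (shifted_D _ gu) (shifted_D _ gv)).
  by apply: cnt_sub2 => s _; rewrite /uv; case: (D s); rewrite ?andbF ?andbT.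
(* The union of the translates has about 2|a| points, almost all in [D], and [D] has hardly more. *)
have D_uv : cnt M (fun s => D s && ~~ uv s) <= 10 * e.
  have uvE : cnt M uv <= cnt M (fun s => uv s && ~~ D s) + cnt M (fun s => uv s && D s).
    by apply: cnt_sub2 => s _ ->; case: (D s).
  have := cntUI M (fun s => D s && ~~ uv s) (fun s => uv s && D s).
  suff : cnt M (fun s => D s && ~~ uv s || uv s && D s) +
         cnt M (fun s => (D s && ~~ uv s) && (uv s && D s)) <= cnt M D by lia.
  rewrite /cnt -big_split; apply: leq_sum => s _ /=.
  by case: (D s); case: (uv s).
have sums_good x : good x ->
    cnt M (fun s => [&& x <= s, good (s - x) & ~~ uv s]) <= 11 * e.
  case/andP=> _ xe; rewrite mulSn; apply: leq_trans (leq_add xe D_uv).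
  apply: cnt_sub2 => s _ /and3P[-> /andP[-> _] ->].
  by case: (D s).
have ltuv : u < v.
  have : cnt M good <= v.+1 - u.
    apply: leq_trans (cnt_interval M u v.+1); apply: cnt_sub => x _ gx.
    by have := umin _ gx; have := vmax _ gx; lia.
  by lia.
have vn := bound _ gv.
have [m mE] : exists m, v - u = m.+1 by exists (v - u).-1; lia.
(* The good elements, shifted to start at 0 and read modulo [v - u]; the end points become one
   residue, whence the loss of 1 below. *)
pose X := [set t : 'I_m.+1 | good (u + t)].
have X_card : cnt M good <= #|X| + 1.
  have -> : #|X| = cnt m.+1 (fun t => good (u + t)) by rewrite cntE.
  apply: (@leq_trans (cnt M (fun x => good x && (x < v)) + cnt M (pred1 v))).
    apply: cnt_sub2 => x _ gx; rewrite gx /= ; have := vmax _ gx.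
    by case: ltngtP.
  apply: leq_add (cnt_eq1 M v).
  apply: (cnt_inj (f := fun x => x - u)) => [x _ /andP[gx xv]|x y _ _ /andP[gx _] /andP[gy _]].
    by rewrite subnKC ?umin //; split=> //; have := umin _ gx; lia.
  by have := umin _ gx; have := umin _ gy; lia.
have X0 : (0 \in X)%R by rewrite inE addn0.
(* A sum in [uv] makes t + y, or t + y minus the modulus, a shifted good element; so each failure of
   closure in [X] is a sum outside [uv]. *)
have X_sums : {in X, forall t, #|[set y in X | (t + y)%R \notin X]| <= 11 * e}.
  move=> t; rewrite inE => gt; apply: leq_trans (sums_good _ gt).
  pose p y := good (u + y) && ~~ good (u + (t + y) %% m.+1).
  have -> : #|[set y in X | (t + y)%R \notin X]| = cnt m.+1 p.
    by rewrite cntE; apply: eq_card => y; rewrite !inE.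
  apply: (cnt_inj (f := fun y => u + t + (u + y))) => [y ym /andP[gy ngy]|]; last by lia.
  have := bound _ gy; have := bound _ gt; rewrite addKn gy leq_addr /= => ? ?.
  split; first by lia.
  apply/negP; case/orP=> /andP[le1 g1].
    have e1 : u + t + (u + y) - u = u + (t + y) by lia.
    have := vmax _ g1; rewrite e1 in g1; rewrite leq_eqVlt => /orP[/eqP e2|lt2].
      by move: ngy; rewrite (_ : t + y = m.+1) ?modnn ?addn0 ?gu //; lia.
    by move: ngy; rewrite modn_small ?g1 //; lia.
  have le2 := umin _ g1.
  have e1 : u + t + (u + y) - v = u + (t + y - m.+1) by lia.
  rewrite e1 in g1.
  have ty : t + y = (t + y - m.+1) + m.+1 by lia.
  move: ngy; rewrite ty modnDr modn_small ?g1 //.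
  by have := ltn_ord t; lia.
have X_large : 6 * (11 * e) < #|X| by lia.
have [K [XK KD KN K_card]] := almost_closed_sub_subgroup X_large X0 X_sums.
have K0 := subsetP XK _ X0.
have XleK := subset_leq_card XK.
have [d [/andP[d0 d3] dm Kd]] : exists d,
    [/\ 0 < d <= 3, d %| m.+1 & forall t : 'I_m.+1, (t \in K) = (d %| t)].
  (* |X| is at least |a| - e, so [a_large] puts 4|X| above [n], which bounds the modulus. *)
  apply: subgroup_small_index => //.
  have : m.+1 < 4 * #|X| by lia.
  by move=> /leq_trans; apply; rewrite leq_mul2l.
have v_mod : v == u %[mod d] by rewrite eqn_mod_dvd ?mE // ltnW.
have good_mod x : good x -> u <= x <= v /\ x == u %[mod d].
  move=> gx; have ux := umin _ gx; have xv := vmax _ gx.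
  split; first by rewrite ux.
  have [xltv|vx] := ltnP x v; last by have -> : x = v by lia.
  have xu : x - u < m.+1 by lia.
  rewrite eqn_mod_dvd // -[x - u]/(nat_of_ord (Ordinal xu)) -Kd.
  by apply: (subsetP XK); rewrite inE /= subnKC.
(* Apart from the good point [v], the class of [u] in [u, v] is a copy of [K], and [K] exceeds [X]
   by at most 3 * 11e. *)
have misses : cnt M (fun x => [&& u <= x <= v, x == u %[mod d] & ~~ good x]) <= 33 * e.
  apply: (@leq_trans #|K :\: X|); last first.
    by rewrite cardsD (setIidPr XK); lia.
  pose p t := (d %| t) && ~~ good (u + t).
  have -> : #|K :\: X| = cnt m.+1 p.
    by rewrite cntE; apply: eq_card => t; rewrite !inE Kd andbC.
  apply: (cnt_inj (f := fun x => x - u)) => [x _ /and3P[/andP[ux xv] xu ngx]|]; last first.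
    by move=> x y _ _ /and3P[/andP[ux _] _ _] /and3P[/andP[uy _] _ _]; lia.
  rewrite /p subnKC // ngx andbT -eqn_mod_dvd //; split=> //.
  have : x != v by apply: contra ngx => /eqP->.
  by move: mE; lia.
exists u, v, d; split=> //; first by rewrite d0.
split=> //.
- have : cnt M good <= cnt ((v - u) %/ d).+1 predT.
    apply: (cnt_inj (f := fun x => (x - u) %/ d)) => [x _ /good_mod[/andP[ux xv] _]|].
      by rewrite ltnS leq_div2r //; lia.
    move=> x y _ _ /good_mod[/andP[ux _] xu] /good_mod[/andP[uy _] yu] exy.
    rewrite !eqn_mod_dvd // in xu yu.
    have : x - u = y - u by rewrite -(divnK xu) -(divnK yu) exy.
    by move: ux uy; clear; lia.
  rewrite cnt_predT => h.
  have : d * (cnt M good - 1) <= d * ((v - u) %/ d) by rewrite leq_mul2l; lia.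
  by move/leq_trans; apply; rewrite mulnC leq_trunc_div.
(* The lower half of [2u, 2v] is covered by [u] plus the progression, the upper half by [v] plus it;
   each loses 33e missing points and [e] sums outside [D]. *)
- rewrite (_ : 68 * e = (33 * e + e) + (33 * e + e)); last by lia.
  pose Q w s := [&& w <= s, u <= s - w <= v, s - w == u %[mod d] & ~~ D s].
  have Qle w : good w -> cnt M (Q w) <= 33 * e + e.
    move=> gw; apply: leq_trans (leq_add misses (shifted_D _ gw)).
    apply: (@leq_trans (cnt M (fun s => Q w s && ~~ good (s - w)) +
                        cnt M (fun s => Q w s && good (s - w)))).
      by apply: cnt_sub2 => s _ ->; case: (good _).
    apply: leq_add; last first.
      apply: cnt_sub => s _ /andP[/and4P[ws _ _ nD] gs].
      by rewrite /shifted ws gs.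
    apply: (cnt_inj (f := fun s => s - w)) => [s sM|].
      by case/andP=> /and4P[ws -> -> _] ->; split=> //; lia.
    by move=> x y _ _ /andP[/and4P[wx _ _ _] _] /andP[/and4P[wy _ _ _] _]; lia.
  apply: leq_trans (leq_add (Qle _ gu) (Qle _ gv)).
  apply: cnt_sub2 => s _ /and3P[/andP[s1 s2] s3 nD]; rewrite /Q nD !andbT.
  have eu t w : w == u %[mod d] -> (t + w == 2 * u %[mod d]) = (t == u %[mod d]).
    by move=> /eqP wu; rewrite -modnDmr wu modnDmr mul2n -addnn eqn_modDr.
  have [su|us] := leqP s (u + v); [apply/orP; left | apply/orP; right].
    have us : u <= s by move: s1; clear; lia.
    rewrite us -(eu _ u) // subnK // s3 andbT /=.
    by move: s1 su us; clear; lia.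
  have vs : v <= s by move: us ltuv; clear; lia.
  rewrite vs -(eu _ v) // subnK // s3 andbT /=.
  by move: s2 us vs ltuv; clear; lia.
Qed.

End RobustFreiman.

(** * Excluding all progressions but the top third *)

Section Core.
Variables (n e : nat) (a D : pred nat).
Let N := 2 * n + 1.
Let M := N.+1.
Hypothesis a_range : forall x, a x -> 0 < x <= n.
Hypothesis e_gt0 : 0 < e.
Hypothesis e_small : 4000 * e <= n.
Hypothesis a_large : n <= 3 * cnt M a + e.
Hypothesis no_schur : cnt M (fun s => D s && a s) <= e.
Hypothesis no_sum3 : cnt M (fun s => D s && a (N - s)) <= e.
Hypothesis no_sum4 : cnt M (fun s => D s && D (N - s)) <= e.
Hypothesis exc_sum :
  \sum_(x < M) a x * cnt M (fun s => [&& x <= s, a (s - x) & ~~ D s]) <= e * e.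
Hypothesis no_sum5 :
  \sum_(c < M) a c * cnt M (fun s => [&& s <= N - c, D s & D (N - c - s)]) <= e * e.

Let ME : M = 2 * n + 2. Proof. by rewrite /M /N; lia. Qed.

(* [D], [N - D], [a] and [N - a] are almost disjoint subsets of [0, N]. *)
Lemma popular_sums_card : cnt M D <= 2 * cnt M a + 5 * e.
Proof.
suff : 2 * cnt M D + 2 * cnt M a <= M + 5 * e by have := ME; lia.
pose Da s := D s && a s; pose Da' s := D s && a (N - s).
have cDa : cnt M (fun s => D (N - s) && a (N - s)) <= e.
  by rewrite (cnt_refl N Da).
have cDa' : cnt M (fun s => D (N - s) && a s) <= e.
  apply: leq_trans no_sum3; rewrite -(cnt_refl N Da') -/M.
  by apply: cnt_sub => s sM; rewrite /Da' subKn.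
have cD : cnt M (fun s => D (N - s)) = cnt M D by exact: cnt_refl.
have ca : cnt M (fun s => a (N - s)) = cnt M a by exact: cnt_refl.
(* Pointwise, the four indicators add up to at most 1 plus the number of coinciding pairs; [a] and
   [N - a] never meet, as [s] and [N - s] cannot both be at most [n]. *)
have : cnt M D + cnt M (fun s => D (N - s)) + (cnt M a + cnt M (fun s => a (N - s)))
  <= cnt M predT + (cnt M Da + cnt M Da' + cnt M (fun s => D s && D (N - s))
      + (cnt M (fun s => D (N - s) && a (N - s)) + cnt M (fun s => D (N - s) && a s))).
  rewrite /cnt -!big_split; apply: leq_sum => s _ /=; rewrite /Da /Da'.
  have : ~~ (a s && a (N - s)).
    by apply/negP=> /andP[/a_range s1 /a_range]; rewrite /N; lia.
  by case: (D s); case: (D (N - s)); case: (a s); case: (a (N - s)).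
rewrite cnt_predT cD ca.
have : cnt M Da <= e by exact: no_schur.
have : cnt M Da' <= e by exact: no_sum3.
by move: no_sum4 cDa cDa'; lia.
Qed.

(** With about n/3 elements, the progression has v - u at least about dn/3. For d = 2, 3 this makes
    some forbidden equation solvable in its residue class; for d = 1 it forces the position of
    [u]. *)
Lemma almost_in_top_third : cnt M (fun x => a x && (3 * x < 2 * n + 2)) <= 140 * e.
Proof.
have [||||a' [a'a a'_miss]] := @almost_AP n M e a D _ _ e_gt0 _ _ popular_sums_card exc_sum.
- by move=> x /a_range/andP[].
- by rewrite ME; lia.
- by lia.
- by lia.
case=> u [v [d [a'u /andP[d0 d3] a'P vu [dle vn a'_miss' D_miss]]]].
have a'_card : cnt M a <= cnt M a' + e.
  apply: leq_trans (leq_add (leqnn _) a'_miss).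
  by apply: cnt_sub2 => x _ ->; case: (a' x).
have d3e k : d * (k * e) <= 3 * (k * e) by rewrite leq_mul2r d3 orbT.
have uv3 : d * n + 3 * u <= 3 * v + 7 * (d * e).
  have uv : u <= v by case: (a'P _ a'u) => /andP[].
  have : d * n <= d * (3 * (cnt M a' - 1) + 7 * e) by rewrite leq_mul2l; lia.
  by rewrite mulnDr !(mulnCA d); move: uv dle; clear; lia.
have uvn : n + 3 * u <= 3 * v + 21 * e.
  by have := leq_pmull n d0; have := d3e 1; rewrite !mul1n; move: uv3; clear; lia.
clear dle a'_card.
have a_miss' : cnt M (fun x => [&& u <= x <= v, x == u %[mod d] & ~~ a x]) <= 33 * e.
  apply: leq_trans a'_miss'; apply: cnt_sub => x _ /and3P[-> -> /=].
  by apply: contra; apply: a'a.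
(* Otherwise [a] and [D] both almost fill a block starting at 2u, and 138e points exceed 68e + 33e +
   e. Since d <= 3, the block has length at most 414e. *)
have schur : 2 * u == u %[mod d] -> v < 2 * u + 414 * e.
  move=> uu; rewrite ltnNge; apply/negP=> le1.
  have dL : d * (138 * e) <= 414 * e by have := d3e 138; lia.
  have h1 : 2 * u + d * (138 * e) <= M by rewrite ME; lia.
  suff : 138 * e <= 68 * e + 33 * e + cnt M (fun x => D x && a x) by lia.
  apply: (cnt_overlap (r := 2 * u) d0 h1).
    apply: leq_trans D_miss; apply: cnt_sub => s _ /andP[/andP[s1 ->] ->].
    by rewrite andbT; lia.
  apply: leq_trans a_miss'; apply: cnt_sub => s _ /andP[/andP[s1 su] ->].
  by rewrite (eqP su) uu andbT; lia.
have NE : N = 2 * n + 1 by [].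
(* [w] cannot lie well inside the sum of the progressions filled by [D] and [B]: 138 exceeds 68 + 68
   + 1, and 414 = 3 * 138. *)
have avoid (B : pred nat) w b1 b2 r : 2 * u + r == w %[mod d] ->
    cnt M (fun x => [&& b1 <= x <= b2, x == r %[mod d] & ~~ B x]) <= 68 * e ->
    cnt M (fun s => [&& s <= w, D s & B (w - s)]) <= e ->
    ~~ [&& w <= N, b1 + 414 * e <= b2, 2 * u + b1 + 414 * e <= w
         & w + 414 * e <= 2 * v + b2].
  move=> wE B_miss DB; apply/negP=> /and4P[wN le1 le2 le3].
  have dL := d3e 138.
  suff : 138 * e <= 68 * e + 68 * e + cnt M (fun s => [&& s <= w, D s & B (w - s)]).
    by move: DB e_gt0; clear; lia.
  by apply: (cnt_sum_overlap d0 _ _ wE D_miss B_miss);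
    move: uvn vn e_small le1 le2 le3 dL ME NE wN; clear; lia.
have sum3 : 3 * u == N %[mod d] -> 3 * u + 414 * e <= N -> 3 * v < N + 414 * e.
  move=> uN le1; rewrite ltnNge; apply/negP=> le2.
  have h1 : 2 * u + u == N %[mod d] by rewrite -mulSnr.
  have h2 : cnt M (fun x => [&& u <= x <= v, x == u %[mod d] & ~~ a x]) <= 68 * e.
    by apply: leq_trans a_miss' _; rewrite leq_mul2r orbT.
  have h3 : cnt M (fun s => [&& s <= N, D s & a (N - s)]) <= e.
    by apply: leq_trans no_sum3; apply: cnt_sub => s _ /and3P[_ -> ->].
  move/negP: (avoid _ _ _ _ _ h1 h2 h3); apply.
  by move: uvn vn e_small le1 le2; clear; lia.
have sum4 : 4 * u == N %[mod d] -> 4 * u + 414 * e <= N -> 4 * v < N + 414 * e.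
  move=> uN le1; rewrite ltnNge; apply/negP=> le2.
  have h1 : 2 * u + 2 * u == N %[mod d] by rewrite -mulnDl.
  have h3 : cnt M (fun s => [&& s <= N, D s & D (N - s)]) <= e.
    by apply: leq_trans no_sum4; apply: cnt_sub => s _ /and3P[_ -> ->].
  move/negP: (avoid _ _ _ _ _ h1 D_miss h3); apply.
  by move: uvn vn e_small le1 le2; clear; lia.
have sum5 : 5 * u == N %[mod d] -> 5 * u + 600 * e <= N -> 4 * v < N + 414 * e.
  move=> uN le1; rewrite ltnNge; apply/negP=> le2.
  pose f c := cnt M (fun s => [&& s <= N - c, D s & D (N - c - s)]).
  (* Fixing one summand [c] near [u] reduces five terms to four. Of 35e candidates at most 33e are
     missing from [a'] and fewer than [e] have large [f]; 105 = 3 * 35. *)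
  have [c [a'c cu fc]] : exists c, [/\ a' c, c <= u + 105 * e & f c <= e].
    pose J x := (u <= x < u + d * (35 * e)) && (x == u %[mod d]).
    have dL : d * (35 * e) <= 105 * e by have := d3e 35; lia.
    have h1 : 35 * e <= cnt M J by apply: cnt_AP => //; move: dL uvn vn ME e_small; clear; lia.
    have h2 := cnt_markov (f := f) no_sum5 e_gt0.
    have h3 : cnt M J <= cnt M (fun x => [&& u <= x <= v, x == u %[mod d] & ~~ a' x])
        + cnt M (fun x => J x && a' x).
      apply: cnt_sub2 => x _ Jx; rewrite Jx; case: (a' x); rewrite ?orbT //=.
      case/andP: Jx => x1 ->; rewrite andbT orbF.
      by move: x1 dL uvn e_small; clear; lia.
    have h4 : cnt M (fun x => J x && a' x) <= cnt M (fun c => a c && (e < f c))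
        + cnt M (fun x => [&& J x, a' x & f x <= e]).
      by apply: cnt_sub2 => x _ /andP[-> a'x]; rewrite a'x (a'a _ a'x) /=; case: ltnP.
    have /cnt_gt0[c _ /and3P[/andP[c1 _] a'c fc]] :
      0 < cnt M (fun x => [&& J x, a' x & f x <= e]).
      by move: h1 h2 h3 h4 a'_miss'; rewrite -/f; clear; lia.
    by exists c; split=> //; move: c1 dL; clear; lia.
  have [/andP[uc cv] cE] := a'P _ a'c.
  have cN : c <= N by move: cv vn NE; clear; lia.
  have h1 : 2 * u + 2 * u == N - c %[mod d].
    rewrite -(eqn_modDr c) subnK // -(eqP uN) -modnDmr (eqP cE) modnDmr.
    by apply/eqP; congr (_ %% _); clear; lia.
  move/negP: (avoid _ _ _ _ _ h1 D_miss fc); apply.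
  by move: uvn vn e_small le1 le2 uc cu cN; clear; lia.
have dE : [\/ d = 1, d = 2 | d = 3].
  by case: (d) d0 d3 => [|[|[|[|?]]]] //; constructor.
case: dE => {}dE; rewrite {}dE in schur sum3 sum4 sum5 uv3.
- have m1 x y : x == y %[mod 1] by rewrite !modn1.
  have s1 := schur (m1 _ _); have s3 := sum3 (m1 _ _); have s4 := sum4 (m1 _ _).
  (* Up to O(e): if u < 2n/3, three-term sums give v <= 2n/3, so u <= n/3; then four-term sums give
     v <= n/2, while v <= 2u and v - u >= n/3 give v >= 2n/3. *)
  have ugt : N < 3 * u + 414 * e.
    rewrite ltnNge; apply/negP=> le1; have lt2 := s3 le1.
    have : 4 * u + 414 * e <= N.
      by move: uv3 lt2 e_small NE; clear; lia.
    by move/s4; move: uv3 lt2 s1 e_small NE; clear; lia.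
  rewrite (_ : 140 * e = e + 139 * e); last by rewrite -mulSn.
  apply: leq_trans (leq_add a'_miss (_ : cnt M (fun x => u <= x < u + 139 * e) <= _)).
    apply: cnt_sub2 => x _ /andP[-> x3] /=; case a'x: (a' x) => //=.
    have [/andP[ux _] _] := a'P _ a'x.
    by move: ux x3 ugt NE e_gt0; clear; lia.
  by apply: leq_trans (cnt_interval _ _ _) _; rewrite addKn.
(* For d = 2, [u] is at most about n/3. Even [u] allows x + y = z; for odd [u], five odd terms have
   the parity of [N]. *)
- exfalso; have [u0|u1] : u %% 2 = 0 \/ u %% 2 = 1 by clear; lia.
    have : 2 * u == u %[mod 2] by move: u0; clear; lia.
    by move/schur; move: uv3 vn e_small; clear; lia.
  have : 5 * u == N %[mod 2] by move: u1 NE; clear; lia.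
  have h4 : N + 414 * e <= 4 * v by move: uv3 vn NE e_small e_gt0; clear; lia.
  have h5 : 5 * u + 600 * e <= N by move: uv3 vn NE e_small e_gt0; clear; lia.
  by move/sum5/(_ h5); move: h4; clear; lia.
(* For d = 3 the progression spans almost all of [1, n]. Either 3 divides [u] and x + y = z is
   solvable, or 3u, 4u, 5u cover all residues, including that of [N]. *)
- exfalso; have [u0|u1] := eqVneq (u %% 3) 0.
    have : 2 * u == u %[mod 3] by move: u0; clear; lia.
    by move/schur; move: uv3 vn e_small; clear; lia.
  have h4 : N + 414 * e <= 4 * v by move: uv3 vn NE e_small e_gt0; clear; lia.
  have h3 : N + 414 * e <= 3 * v by move: uv3 vn NE e_small e_gt0; clear; lia.
  have h5 : 5 * u + 600 * e <= N by move: uv3 vn NE e_small e_gt0; clear; lia.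
  have [N3|N4|N5] : [\/ 3 * u == N %[mod 3], 4 * u == N %[mod 3] | 5 * u == N %[mod 3]].
  + suff : 3 * u == N %[mod 3] \/ 4 * u == N %[mod 3] \/ 5 * u == N %[mod 3].
      by case=> [|[|]] ?; [constructor 1 | constructor 2 | constructor 3].
    by move: u1 {h3 h4 h5}; clear; lia.
  + by have := sum3 N3; move: h3 h5; clear; lia.
  + by have := sum4 N4; move: h4 h5; clear; lia.
  + by have := sum5 N5 h5; move: h4; clear; lia.
Qed.
End Core.

(** * Counting solutions by generating polynomials *)

Lemma card_le_fibers (T U : finType) (W : {set T}) (B : {set U}) (f : T -> U) c :
  {in W, forall x, f x \in B} ->
  {in B, forall y, #|[set x in W | f x == y]| <= c} -> #|W| <= c * #|B|.
Proof.
move=> WB Bc; rewrite -sum1_card (partition_big f (mem B)) //= mulnC -sum_nat_const.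
by apply: leq_sum => y /Bc; rewrite -sum1_card; congr (_ <= _); apply: eq_bigl => x; rewrite inE.
Qed.

Section Tuples.
Variables (n : nat) (A : {set 'I_n.+1}).
Implicit Types k s : nat.

(** The guard is needed because [inord] sends values above [n] to 0. *)
Definition ind (x : nat) : bool := (x <= n) && (inord x \in A).

(** The coefficients of its k-th power count ordered k-tuples from [A] by their sum; factoring the
    power splits the tuples into blocks. *)
Definition gen : {poly nat} := (\sum_(x in A) 'X^x)%R.

Lemma coef_gen j : (gen`_j)%R = ind j.
Proof.
rewrite /gen coef_sum /ind; under eq_bigr do rewrite coefXn.
have [jn|jn] := leqP j n; last first.
  by rewrite big1 // => x _; case: eqP => // jx; have := ltn_ord x; lia.
rewrite big_mkcond (bigD1 (inord j)) //= inordK // eqxx big1 ?addr0; last first.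
  move=> x xj; case: ifP => // _; case: eqP => // jx.
  by move: xj; rewrite jx inord_val eqxx.
by case: ifP.
Qed.

Definition tuples k s : {set {ffun 'I_k -> 'I_n.+1}} :=
  [set f | (f \in ffun_on (mem A)) && (\sum_i f i == s)].

Lemma coef_genX k s : ((gen ^+ k)`_s)%R = #|tuples k s|.
Proof.
rewrite -[k in LHS]card_ord -prodr_const /gen bigA_distr_big /= coef_sum.
rewrite -sum1_card /tuples; under [RHS]eq_bigl do rewrite inE.
rewrite [RHS]big_mkcondr /=; apply: eq_big => [f|f _]; first by [].
rewrite -expr_sum coefXn eq_sym.
by case: eqP.
Qed.

(** The sum and the other k - 2 entries determine twice the repeated entry. *)
Lemma card_tuples_eq k s (i j : 'I_k) : i != j ->
  #|[set f in tuples k s | f i == f j]| <= n.+1 ^ (k - 2).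
Proof.
move=> ij; pose D : {set 'I_k} := [set~ i] :\ j.
have cD : #|D| = k - 2.
  have : #|[set~ i]| = (j \in [set~ i]) + #|D| by rewrite /D -cardsD1.
  by rewrite cardsC1 card_ord !inE eq_sym ij; lia.
have cR : #|[set: 'I_n.+1]| = n.+1 by rewrite cardsT card_ord.
rewrite -cD -[in leqRHS]cR -(card_pffun_on ord0).
pose h (f : {ffun 'I_k -> 'I_n.+1}) := [ffun l => if l \in D then f l else ord0].
rewrite -(card_in_imset (f := h)); last first.
  move=> f g; rewrite !inE => /andP[/andP[_ /eqP fs] /eqP fij] /andP[/andP[_ /eqP gs] /eqP gij] hfg.
  have fg l : l \in D -> f l = g l.
    by move=> lD; move/ffunP/(_ l): hfg; rewrite !ffunE lD.
  have sumE (f' : {ffun 'I_k -> 'I_n.+1}) : \sum_l f' l = f' i + (f' j + \sum_(l in D) f' l).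
    rewrite (bigD1 i) // (bigD1 j) 1?eq_sym //=; congr (_ + (_ + _)).
    by apply: eq_bigl => l; rewrite !inE andbC.
  have fgs : \sum_(l in D) f l = \sum_(l in D) g l.
    by apply: eq_bigr => l lD; rewrite fg.
  have fgi : f i = g i.
    apply: val_inj => /=; move: fs gs; rewrite !sumE fgs -fij -gij => <- /eqP.
    by rewrite !addnA eqn_add2r !addnn => /eqP/double_inj.
  apply/ffunP=> l; have [/fg //|] := boolP (l \in D).
  rewrite !inE negb_and !negbK => /orP[/eqP->|/eqP->] //.
  by rewrite -fij -gij.
apply: subset_leq_card; apply/subsetP=> _ /imsetP[f _ ->].
apply/pffun_onP; split=> [|y /imageP[l _ ->]]; last by rewrite inE.
by apply/supportP=> l lD; rewrite ffunE (negbTE lD).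
Qed.

Definition inj_tuples k s := [set f in tuples k s | injectiveb f].

(** Union bound over the k^2 pairs of positions at which an entry may repeat. *)
Lemma card_tuples k s : #|tuples k s| <= #|inj_tuples k s| + k * k * n.+1 ^ (k - 2).
Proof.
rewrite -(cardsID [set f : {ffun 'I_k -> 'I_n.+1} | injectiveb f]); apply: leq_add.
  by apply: subset_leq_card; apply/subsetP=> f; rewrite !inE.
pose E (p : 'I_k * 'I_k) := [set f in tuples k s | (p.1 != p.2) && (f p.1 == f p.2)].
apply: (@leq_trans (\sum_p #|E p|)).
  under eq_bigr do rewrite -sum1_card big_mkcond.
  rewrite exchange_big -sum1_card big_mkcond /=; apply: leq_sum => f _.
  case: ifP => //; rewrite !inE => /andP[nf fT].
  have /injectivePn[i [j ij fij]] := nf.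
  by rewrite (bigD1 (i, j)) //= !inE /= fT ij fij eqxx.
have -> : k * k * n.+1 ^ (k - 2) = \sum_(p : 'I_k * 'I_k) n.+1 ^ (k - 2).
  by rewrite sum_nat_const card_prod card_ord.
apply: leq_sum => -[i j] _; have [ij|ij] := eqVneq i j.
  by rewrite (_ : E _ = set0) ?cards0 //; apply/setP=> f; rewrite !inE /= ij eqxx andbF.
apply: leq_trans (card_tuples_eq s ij); apply: subset_leq_card.
by apply/subsetP=> f; rewrite !inE /= => /andP[-> /andP[_ ->]].
Qed.

Hypothesis A_seg : A \subset segment n.

Let configs k := [set F in config_family n k | F \subset A].

Lemma imset_tuple k s f : f \in inj_tuples k s ->
  [/\ f @: setT \subset A, #|f @: setT| = k & \sum_(x in f @: setT) (x : nat) = s].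
Proof.
rewrite !inE -andbA => /and3P[/ffun_onP fA /eqP fs /injectiveP fi]; split.
- by apply/subsetP=> _ /imsetP[i _ ->]; apply: fA.
- by rewrite card_imset // cardsT card_ord.
- rewrite big_imset /=; last by move=> i j _ _; apply: fi.
  by rewrite -fs; apply: eq_bigl => i; rewrite inE.
Qed.

Lemma card_image_fiber k (W : {set {ffun 'I_k -> 'I_n.+1}})
    (g : {ffun 'I_k -> 'I_n.+1} -> {set 'I_n.+1}) m (F : {set 'I_n.+1}) :
  {in W, forall f : {ffun 'I_k -> 'I_n.+1}, f @: setT \subset g f} -> #|F| <= m ->
  #|[set f in W | g f == F]| <= m ^ k.
Proof.
move=> Wg Fm; apply: (@leq_trans (#|F| ^ k)); last first.
  by case: k {W g Wg} => // k; rewrite leq_exp2r.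
rewrite -[k in leqRHS]card_ord -card_ffun_on; apply: subset_leq_card.
apply/subsetP=> f; rewrite inE => /andP[/Wg fg /eqP gF].
by apply/ffun_onP=> i; rewrite -gF (subsetP fg) // imset_f.
Qed.

Lemma card_family3 (F : {set 'I_n.+1}) : F \in family3 n -> #|F| <= 3.
Proof.
rewrite inE => /andP[_ /existsP[x /existsP[y /existsP[z /and5P[_ _ _ /eqP-> _]]]]].
rewrite -setUA (leq_trans (leq_card_setU _ _)) // cards1.
by rewrite ltnS (leq_trans (leq_card_setU _ _)) // !cards1.
Qed.

(** The entries of a tuple form a configuration, which arises from at most k^k tuples. *)
Lemma card_sum_tuples k : 2 < k ->
  #|inj_tuples k (2 * n + 1)| <= k ^ k * #|configs k|.
Proof.
move=> k2; apply: (card_le_fibers (f := fun f : {ffun 'I_k -> 'I_n.+1} => f @: setT)).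
  move=> f fW; have [fA fk fs] := imset_tuple fW.
  rewrite inE fA andbT /config_family; case: eqP => [k3|_]; last first.
    by rewrite inE (subset_trans fA A_seg) fk fs !eqxx.
  subst k; rewrite inE (subset_trans fA A_seg) /=.
  have /injectiveP fi : injectiveb f by move: fW; rewrite inE => /andP[].
  pose i1 : 'I_3 := lift ord0 ord0; pose i2 : 'I_3 := lift ord0 (lift ord0 ord0).
  apply/existsP; exists (f ord0); apply/existsP; exists (f i1); apply/existsP; exists (f i2).
  rewrite !(inj_eq fi) /=; apply/andP; split; last first.
    rewrite -(eqP (_ : \sum_i f i == 2 * n + 1)).
      by rewrite !big_ord_recl big_ord0 addn0 addnA eqxx orbT.
    by move: fW; rewrite !inE => /andP[/andP[_ ->]].
  apply/eqP/setP=> x; rewrite !inE; apply/imsetP/idP.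
    case=> [[[|[|[|?]]] hi] // _ ->]; apply/orP.
    - by left; apply/orP; left; apply/eqP; congr (f _); apply: val_inj.
    - by left; apply/orP; right; apply/eqP; congr (f _); apply: val_inj.
    - by right; apply/eqP; congr (f _); apply: val_inj.
  by case/orP=> [/orP[]|] /eqP->; [exists ord0|exists i1|exists i2].
move=> F; rewrite inE => /andP[Fk _]; apply: card_image_fiber => //.
move: Fk; rewrite /config_family; case: eqP => [->|_]; first exact: card_family3.
rewrite inE.
by case/and3P=> _ /eqP->.
Qed.

(** A pair together with its sum is a configuration; positivity keeps the sum apart from both terms.
    A set of at most 3 elements arises from at most 3^2 pairs. *)
Lemma card_schur_tuples :
  #|[set f : {ffun 'I_2 -> 'I_n.+1} | [&& f \in ffun_on (mem A), injectiveb f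
       & ind (\sum_i f i)]]| <= 9 * #|configs 3|.
Proof.
pose g (f : {ffun 'I_2 -> 'I_n.+1}) := (inord (\sum_i f i) : 'I_n.+1) |: f @: setT.
apply: (card_le_fibers (f := g)) => [f|F]; last first.
  rewrite inE => /andP[/card_family3 Fle _]; apply: (card_image_fiber (m := 3)) => // f _.
  exact: subsetUr.
rewrite inE => /and3P[/ffun_onP fA /injectiveP fi /andP[sn sA]].
pose i1 : 'I_2 := lift ord0 ord0.
have sE : \sum_i f i = f ord0 + f i1 by rewrite !big_ord_recl big_ord0 addn0.
have gA : g f \subset A.
  rewrite subUset sub1set sA /=; apply/subsetP=> _ /imsetP[i _ ->]; exact: fA.
rewrite inE gA andbT inE (subset_trans gA A_seg) /=.
have pos i : 0 < f i by have := subsetP A_seg _ (fA i); rewrite inE.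
apply/existsP; exists (f ord0); apply/existsP; exists (f i1).
apply/existsP; exists (inord (\sum_i f i)).
rewrite sE in sn *.
have := pos ord0; have := pos i1 => p1 p0.
have n0 : f ord0 != inord (f ord0 + f i1).
  by rewrite -val_eqE /= inordK // -[X in X != _]addn0 eqn_add2l eq_sym -lt0n.
have n1 : f i1 != inord (f ord0 + f i1).
  by rewrite -val_eqE /= inordK // -[X in X != _]add0n eqn_add2r eq_sym -lt0n.
rewrite (inj_eq fi) n0 n1 inordK // eqxx /= andbT.
apply/eqP/setP=> x; rewrite !inE sE orbC; congr (_ || _).
apply/imsetP/idP.
  case=> [[[|[|?]] hi] // _ ->]; apply/orP.
  - by left; apply/eqP; congr (f _); apply: val_inj.
  - by right; apply/eqP; congr (f _); apply: val_inj.
by case/orP=> /eqP->; [exists ord0|exists i1].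
Qed.

End Tuples.

(** * From few configurations to few coincidences among popular sums *)

Section FewConfigurations.
Variables (n : nat) (A : {set 'I_n.+1}).
Hypothesis A_seg : A \subset segment n.
Let N := 2 * n + 1.
Let M := N.+1.
Let a := ind A.
Let r s : nat := ((gen A ^+ 2)`_s)%R.
Let configs k := [set F in config_family n k | F \subset A].

Let a_range x : a x -> 0 < x <= n.
Proof.
case/andP=> xn /(subsetP A_seg); rewrite inE inordK // => ->.
by rewrite xn.
Qed.

Lemma cnt_ind : cnt M a = #|A|.
Proof.
apply/eqP; rewrite eqn_leq cntE; apply/andP; split.
  rewrite -(card_in_imset (f := fun x : 'I_M => inord x : 'I_n.+1)).
    by apply: subset_leq_card; apply/subsetP=> _ /imsetP[x + ->]; rewrite inE => /andP[].
  move=> x y; rewrite !inE => /andP[xn _] /andP[yn _] /(congr1 val) /=.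
  by rewrite !inordK // => /val_inj.
have nM : n.+1 <= M by rewrite /M /N; lia.
rewrite -(card_in_imset (f := widen_ord nM)); last first.
  by move=> x y _ _ /(congr1 val) /= /val_inj.
apply: subset_leq_card; apply/subsetP=> _ /imsetP[x xA ->].
by rewrite inE /a /ind /= -ltnS ltn_ord inord_val.
Qed.

Let rE s : r s = \sum_(x < s.+1) a x * a (s - x).
Proof.
by rewrite /r expr2 coefM; apply: eq_bigr => x _; rewrite !coef_gen.
Qed.

(** Pairs with equal entries cost at most 4 for each [s]; every other pair is counted only at its
    own sum. *)
Lemma schur_count : \sum_(s < M) a s * r s <= 9 * #|configs 3| + 4 * n.+1.
Proof.
have rle s : r s <= #|inj_tuples A 2 s| + 4.
  by rewrite /r coef_genX; apply: leq_trans (card_tuples _ _ _) _; rewrite muln1.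
apply: (@leq_trans (\sum_(s < M) (a s * #|inj_tuples A 2 s| + 4 * a s))).
  by apply: leq_sum => s _; rewrite [4 * _]mulnC -mulnDr leq_mul2l rle orbT.
rewrite big_split; apply: leq_add; last first.
  rewrite -big_distrr leq_mul2l /= -[X in X <= _]/(cnt M a).
  apply: leq_trans (cnt_interval M 0 n.+1); apply: cnt_sub => x _.
  by case/a_range/andP.
apply: leq_trans (card_schur_tuples A_seg).
under eq_bigr do rewrite -sum1_card big_distrr /= big_mkcond.
rewrite exchange_big -sum1_card [leqRHS]big_mkcond /=; apply: leq_sum => f _.
rewrite inE; case: ifP => h.
  apply: (@leq_trans (cnt M (pred1 (\sum_i f i)))); last exact: cnt_eq1.
  apply: leq_sum => s _; rewrite !inE /= eq_sym.
  by case: eqP => [_|_]; rewrite ?andbF //=; case: ifP => //; case: (a s).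
rewrite big1 // => s _; case: ifP => //; rewrite inE => /andP[].
rewrite inE => /andP[fA /eqP fs] fi.
by move: h; rewrite fA fi fs /= -/(a s) => ->.
Qed.

(** This sum and the next two are the coefficients at [N] of gen^3, gen^4 and gen^5, with factors
    gen^2 split off; 27, 256 and 3125 are k^k. *)
Lemma sum3_count : \sum_(s < M) a (N - s) * r s <= 27 * #|configs 3| + 9 * n.+1.
Proof.
have -> : \sum_(s < M) a (N - s) * r s = #|tuples A 3 N|.
  rewrite -coef_genX exprS coefMr; apply: eq_bigr => s _.
  by rewrite coef_gen.
apply: leq_trans (card_tuples _ _ _) _.
by apply: leq_add => //; apply: card_sum_tuples.
Qed.

Lemma sum4_count : \sum_(s < M) r s * r (N - s) <= 256 * #|configs 4| + 16 * n.+1 ^ 2.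
Proof.
have -> : \sum_(s < M) r s * r (N - s) = #|tuples A 4 N|.
  by rewrite -coef_genX (exprD _ 2 2) coefM.
apply: leq_trans (card_tuples _ _ _) _.
by apply: leq_add => //; apply: card_sum_tuples.
Qed.

Lemma sum5_count : \sum_(c < M) a c * (\sum_(s < (N - c).+1) r s * r (N - c - s))
  <= 3125 * #|configs 5| + 25 * n.+1 ^ 3.
Proof.
have -> : \sum_(c < M) a c * (\sum_(s < (N - c).+1) r s * r (N - c - s))
    = #|tuples A 5 N|.
  rewrite -coef_genX (exprD _ 1 4) coefM; apply: eq_bigr => c _.
  by rewrite expr1 coef_gen (exprD _ 2 2) coefM.
apply: leq_trans (card_tuples _ _ _) _.
by apply: leq_add => //; apply: card_sum_tuples.
Qed.

(** [e] is the error unit and [t] the popularity threshold. In the bounds below, powers of [t] match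
    the factors [r] of each weighted sum, and powers of [e] bound what remains after division. *)
Variables e t : nat.
Hypotheses (e_gt0 : 0 < e) (t_gt0 : 0 < t) (e_small : 4000 * e <= n).
Hypothesis A_large : n <= 3 * #|A| + e.
Hypothesis t_small : (2 * n + 2) * t <= e * e.
Hypothesis few3 : 27 * #|configs 3| + 9 * n.+1 <= t * e.
Hypothesis few4 : 256 * #|configs 4| + 16 * n.+1 ^ 2 <= t * t * e.
Hypothesis few5 : 3125 * #|configs 5| + 25 * n.+1 ^ 3 <= t * t * (e * e).

Let D s := t <= r s.

Lemma few_configs_top_third : cnt M (fun x => a x && (3 * x < 2 * n + 2)) <= 140 * e.
Proof.
have DM c (p : pred nat) (f : nat -> nat) : 0 < c -> (forall s, s < M -> p s -> c <= f s) ->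
    \sum_(s < M) f s <= c * e -> cnt M p <= e.
  move=> c0 pf fe; rewrite -(leq_pmul2l c0); apply: leq_trans fe.
  rewrite /cnt big_distrr; apply: leq_sum => s _ /=.
  by have := pf s (ltn_ord s); case: (p s) => [/(_ isT)|_]; rewrite ?muln1 ?muln0.
have ME : M = 2 * n + 2 by rewrite /M /N; lia.
apply: (almost_in_top_third (D := D)) => //.
- by rewrite cnt_ind.
- apply: (DM t _ (fun s => a s * r s)) => // [s _ /andP[Ds ->]|]; first by rewrite mul1n.
  by apply: leq_trans schur_count _; apply: leq_trans few3; lia.
- apply: (DM t _ (fun s => a (N - s) * r s)) => // [s _ /andP[Ds ->]|].
    by rewrite mul1n.
  exact: leq_trans sum3_count few3.
- apply: (DM (t * t) _ (fun s => r s * r (N - s))) => //; first by rewrite muln_gt0 t_gt0.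
    by move=> s _ /andP[? ?]; apply: leq_mul.
  exact: leq_trans sum4_count few4.
(* After exchanging the sums, a popular [s] contributes nothing and any other at most its [r s < t]
   representations. *)
- apply: leq_trans t_small; rewrite -ME.
  have -> : M * t = \sum_(s < M) t by rewrite sum_nat_const card_ord.
  under eq_bigr do rewrite /cnt big_distrr.
  rewrite exchange_big /=; apply: leq_sum => s _.
  have [Ds|] := leqP t (r s).
    by rewrite big1 // => x _; rewrite /D Ds !andbF muln0.
  move=> /ltnW; apply: leq_trans; rewrite rE.
  rewrite (big_ord_widen M (fun x => a x * a (s - x))) ?ltn_ord //.
  rewrite [leqRHS]big_mkcond; apply: leq_sum => x _ /=.
  by rewrite ltnS; case: (x <= s) => //=; case: (a x); case: (a (s - x)); case: (D s).
- have tt0 : 0 < t * t by rewrite muln_gt0 t_gt0.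
  rewrite -(leq_pmul2l tt0); apply: leq_trans few5; apply: leq_trans sum5_count.
  rewrite big_distrr; apply: leq_sum => c _ /=.
  rewrite mulnCA leq_mul2l; apply/orP; right.
  rewrite (big_ord_widen M (fun s => r s * r (N - c - s))); last by rewrite ltnS leq_subr.
  rewrite [leqRHS]big_mkcond /cnt big_distrr; apply: leq_sum => s _ /=.
  rewrite ltnS; case: (s <= N - c) => /=; last by rewrite muln0.
  by case: andP => [[D1 D2]|_]; rewrite ?muln0 // muln1 leq_mul.
Qed.

End FewConfigurations.

(** * Choice of the constants *)

Lemma mem_top_third n (x : 'I_n.+1) :
  (x \in top_third n) = (0 < x) && (2 * n + 2 <= 3 * x).
Proof.
rewrite !inE ceil_le_int pmulrn; congr (_ && _).
rewrite -(ler_pM2l (x := 3%:R%R : rat)) // mulrA (mulrC 3%:R%R) divfK //.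
by rewrite -!natrM ler_nat; lia.
Qed.

Lemma card_setD_top_third n (A : {set 'I_n.+1}) : A \subset segment n ->
  #|A :\: top_third n| <= cnt (2 * n + 1).+1 (fun x => ind A x && (3 * x < 2 * n + 2)).
Proof.
move=> A_seg; set M := (2 * n + 1).+1.
have nM : n.+1 <= M by rewrite /M; lia.
rewrite cntE -(card_in_imset (f := widen_ord nM)); last first.
  by move=> x y _ _ /(congr1 val) /= /val_inj.
apply: subset_leq_card; apply/subsetP=> _ /imsetP[x + ->].
rewrite in_setD mem_top_third [in X in _ -> X]inE /= => /andP[xB xA].
have := subsetP A_seg _ xA; rewrite inE => x0; rewrite x0 /= -ltnNge in xB.
by rewrite xB andbT /ind -ltnS ltn_ord inord_val.
Qed.

Local Open Scope ring_scope.

(** The integer part loses less than 1, hence at most x / 2. This serves to choose [e] and [t] as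
    integers. *)
Lemma exists_nat_half (R : realType) (x : R) : 2 <= x ->
  exists m : nat, m%:R <= x /\ x / 2 <= m%:R.
Proof.
move=> x2; exists (Num.truncn x).
have x0 : 0 <= x by lra.
have /andP[le1 lt2] := truncn_itv x0.
by split=> //; move: lt2; rewrite -natr1; lra.
Qed.

Theorem theorem1p2 (R : realType) (eps : R) (eps_gt0 : 0 < eps) :
  exists2 delta : R, 0 < delta &
  exists n0 : nat, forall n : nat, (n0 <= n)%N ->
  forall A : {set 'I_n.+1}, A \subset segment n ->
    (1 / 3%:R - delta) * n%:R <= #|A|%:R ->
    (exists2 k : nat, k \in [:: 3; 4; 5]%N &
       delta * n%:R ^+ (k - 1) <= #|[set F in config_family n k | F \subset A]|%:R)
    \/ #|A :\: top_third n|%:R <= eps * n%:R.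
Proof.
(* [e] will be about tau n; 4000 yields both 4000e <= n and 140e <= eps n. *)
pose tau : R := Num.min eps 1 / 4000%:R.
have tau_gt0 : 0 < tau by rewrite divr_gt0 ?ltr0n // lt_min eps_gt0 ltr01.
have tau_eps : 140 * tau <= eps.
  have : Num.min eps 1 <= eps by rewrite ge_min lexx.
  by rewrite /tau; lra.
have tau_le1 : 4000 * tau <= 1.
  have : Num.min eps 1 <= 1 by rewrite ge_min lexx orbT.
  by rewrite /tau; lra.
(* [t] will be about gam n; 16 is chosen so that (2n + 2)t <= 4n gam n = (tau n / 2)^2 <= e^2. *)
pose gam : R := tau ^+ 2 / 16.
have gam_gt0 : 0 < gam by rewrite divr_gt0 ?exprn_gt0.
have gam_le1 : gam <= 1 by rewrite /gam; nra.
(* The density of t^2 e^2, also a lower bound for those of t e and t^2 e. *)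
pose kap : R := gam ^+ 2 * tau ^+ 2.
have kap_gt0 : 0 < kap by rewrite mulr_gt0 ?exprn_gt0.
have gt_gt0 : 0 < gam * tau by rewrite mulr_gt0.
have tau1 : tau <= 1 by lra.
have gt_tau : gam * tau <= tau by rewrite ler_piMl // ltW.
have gt_gam : gam * tau <= gam by rewrite ler_piMr // ltW.
have kap_gt : kap <= gam * tau.
  by rewrite /kap -exprMn expr2 ler_piMr ?ltW //; lra.
have kap_ggt : kap <= gam ^+ 2 * tau.
  rewrite /kap [tau ^+ 2]expr2 mulrA; apply: ler_piMr => //.
  by rewrite mulr_ge0 ?exprn_ge0 ?ltW.
(* From k = 5: t^2 e^2 >= kap n^4 / 16, half of which absorbs degenerate tuples, and 32 * 3125 =
   100000. *)
exists (kap / (1000 * 100)); first by rewrite divr_gt0 // mulr_gt0 ?ltr0n.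
(* This gives kap n >= 6400 = 32 * 200, so that 25(n + 1)^3 <= 200n^3 <= kap n^4 / 32. *)
exists (Num.truncn (64 * 100 / kap)).+1 => n n_large A A_seg A_large.
have kn : 64 * 100 <= kap * n%:R.
  rewrite [kap * _]mulrC -ler_pdivrMr //; apply: le_trans (ltW (truncnS_gt _)) _.
  by rewrite ler_nat.
pose x : R := n%:R; rewrite -/x in kn A_large *.
have x0 : 0 < x.
  rewrite lt_neqAle ler0n andbT; apply/eqP=> x0.
  by move: kn; rewrite -x0 mulr0; clear; lra.
have large y : kap <= y -> 64 * 100 <= y * x.
  by move=> ky; apply: le_trans kn _; rewrite ler_pM2r.
have gx : 64 * 100 <= gam * x by apply/large/(le_trans kap_gt).
have tx : 64 * 100 <= tau * x by apply/large/(le_trans kap_gt).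
have x1 : 64 * 100 <= x.
  by have := large 1 _; rewrite mul1r; apply; move: tau1 gt_tau kap_gt; clear; lra.
have [t [t_le t_ge]] : exists t : nat, t%:R <= gam * x /\ gam * x / 2 <= t%:R.
  by apply: exists_nat_half; move: gx; clear; lra.
have [e [e_le e_ge]] : exists e : nat, e%:R <= tau * x /\ tau * x / 2 <= e%:R.
  by apply: exists_nat_half; move: tx; clear; lra.
have gx0 : 0 <= gam * x / 2 by rewrite divr_ge0 // mulr_ge0 // ltW.
have tx0 : 0 <= tau * x / 2 by rewrite divr_ge0 // mulr_ge0 // ltW.
have t_gt0 : (0 < t)%N by rewrite -(ltr0n R); move: gx t_ge; clear; lra.
have e_gt0 : (0 < e)%N by rewrite -(ltr0n R); move: tx e_ge; clear; lra.
have te : gam * tau * x ^+ 2 / 4 <= (t * e)%:R.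
  rewrite natrM; apply: le_trans (ler_pM gx0 tx0 t_ge e_ge).
  by rewrite le_eqVlt; apply/orP; left; apply/eqP; field.
have tte : gam ^+ 2 * tau * x ^+ 3 / 8 <= (t * t * e)%:R.
  rewrite -mulnA natrM; apply: le_trans (ler_pM gx0 _ t_ge te).
    by rewrite le_eqVlt; apply/orP; left; apply/eqP; field.
  by rewrite divr_ge0 // mulr_ge0 ?exprn_ge0 // ltW.
have ttee : kap * x ^+ 4 / 16 <= (t * t * (e * e))%:R.
  rewrite mulnACA natrM; apply: le_trans (ler_pM _ _ te te).
  - by rewrite le_eqVlt /kap; apply/orP; left; apply/eqP; field.
  - by rewrite divr_ge0 // mulr_ge0 ?exprn_ge0 // ltW.
  - by rewrite divr_ge0 // mulr_ge0 ?exprn_ge0 // ltW.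
pose configs k := [set F in config_family n k | F \subset A].
have [few3|many3] := leqP (27 * #|configs 3| + 9 * n.+1) (t * e); last first.
  left; exists 3%N => //=; rewrite -/(configs 3).
  move: many3; rewrite -(ltr_nat R) natrD natrM [(9 * _)%:R]natrM -natr1 -/x => many3.
  have p1 : 64 * 100 * x <= gam * tau * x ^+ 2.
    by rewrite expr2 mulrA ler_pM2r //; apply: large.
  have p2 : kap * x ^+ 2 <= gam * tau * x ^+ 2 by rewrite ler_pM2r // exprn_gt0.
  by move: te many3 p1 p2 x1; clear; lra.
have [few4|many4] := leqP (256 * #|configs 4| + 16 * n.+1 ^ 2) (t * t * e); last first.
  left; exists 4%N => //=; rewrite -/(configs 4).
  move: many4; rewrite -(ltr_nat R) natrD natrM [(16 * _)%:R]natrM natrX -natr1 -/x => many4.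
  have p1 : 64 * 100 * x ^+ 2 <= gam ^+ 2 * tau * x ^+ 3.
    by rewrite [x ^+ 3]exprS mulrA ler_pM2r ?exprn_gt0 //; apply: large.
  have p2 : kap * x ^+ 3 <= gam ^+ 2 * tau * x ^+ 3 by rewrite ler_pM2r // exprn_gt0.
  have p3 : (x + 1) ^+ 2 <= 4 * x ^+ 2 by move: x1; clear; nra.
  by move: tte many4 p1 p2 p3 (sqr_ge0 x); clear; lra.
have [few5|many5] :=
    leqP (3125 * #|configs 5| + 25 * n.+1 ^ 3) (t * t * (e * e)); last first.
  left; exists 5%N => //=; rewrite -/(configs 5).
  move: many5; rewrite -(ltr_nat R) natrD natrM [(25 * _)%:R]natrM natrX -natr1 -/x => many5.
  have p1 : 64 * 100 * x ^+ 3 <= kap * x ^+ 4.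
    by rewrite [x ^+ 4]exprS mulrA ler_pM2r // exprn_gt0.
  have p3 : (x + 1) ^+ 3 <= (2 * x) ^+ 3 
    by apply: lerXn2r; rewrite ?nnegrE; move: x1; clear; lra.
  by move: p3 ttee many5 p1; rewrite exprMn; clear; lra.
right; have e_small : (4000 * e <= n)%N.
  rewrite -(ler_nat R) natrM -/x.
  have : 4000 * tau * x <= 1 * x by rewrite ler_pM2r.
  by move: e_le; clear; lra.
have A_large' : (n <= 3 * #|A| + e)%N.
  rewrite -(ler_nat R) natrD natrM -/x.
  have : kap * x <= tau * x by rewrite ler_pM2r //; apply: le_trans gt_tau.
  have : 0 < tau * x by rewrite mulr_gt0.
  by move: A_large e_ge; clear; lra.
have t_small : ((2 * n + 2) * t <= e * e)%N.
  rewrite -(ler_nat R) [in leRHS]natrM natrM natrD natrM -/x.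
  apply: le_trans (ler_pM tx0 tx0 e_ge e_ge).
  have -> : tau * x / 2 * (tau * x / 2) = 4 * x * (gam * x) by rewrite /gam; field.
  by apply: ler_pM => //; move: x1; clear; lra.
have := few_configs_top_third A_seg e_gt0 t_gt0 e_small A_large' t_small few3 few4 few5.
move/(leq_trans (card_setD_top_third A_seg)); rewrite -(ler_nat R) natrM.
have : 140 * tau * x <= eps * x by rewrite ler_pM2r.
by move: e_le; clear; lra.
Qed.
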